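(* Let $\alpha\ge0$ and $\varepsilon\in(0,1)$. Assume $(\mathrm{A}_1)$–$(\mathrm{A}_3)$ as spelled out in the context, let $(\gamma_k)_{k\ge1}$ be a non-increasing sequence of positive regularization parameters with associated regularizations $\mathcal{R}_{\gamma_k}$ of $\mathcal{R}$, with exponent $\sigma>0$, let $\eta>0$ and $M=\eta+\varepsilon^\alpha\delta_1$. Suppose there are $\omega\in(0,1)$ and $C>0$ such that $\gamma_{k-1}^\sigma/\gamma_k\le C\omega^k$ for all $k\ge2$, that $$\omega+\sqrt{\frac{M}{\underline\gamma C_p^{-1}+M}}<1,$$ and that $$\omega+\sqrt{\frac{(\eta+\delta_1)|Y_l|}{|A^0|c_p^{-1}+(\eta+\delta_1)|Y_l|}}<1,$$ where $c_p>0$ is the Poincaré constant of $\Omega$, i.e. $\|u\|^2_{L^2(\Omega)}\le c_p\|\nabla u\|^2_{L^2(\Omega)}$ for all $u\in H^1_0(\Omega)$. Then the macroscopic iterative sequence $\{u_0^k\}_{k\ge1}$ defined in the context is Cauchy in $H^1_0(\Omega)$.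
   Context: Geometry. Let $d\in\{2,3\}$, $\Omega\subset\mathbb{R}^d$ a bounded polygonal (polyhedral) domain, $Y=[0,1]^d$ the periodicity cell. $Y_l\subset Y$ is the pore part of the cell, i.e. $Y$ minus a hole with Lipschitz boundary $\Gamma$ (with connected periodic extension of $Y_l$), and $|Y_l|$ is its volume. For $\varepsilon\in(0,1)$, $\Omega^\varepsilon\subset\Omega$ is the perforated domain obtained from $\Omega$ by removing $\varepsilon$-scaled, $\varepsilon$-periodically repeated copies of the hole; it is bounded, connected, with Lipschitz boundary consisting of $\Gamma^\varepsilon$ (boundaries of the removed holes) and $\Gamma^{\mathrm{ext}}=\partial\Omega$. $V^\varepsilon=\{u\in H^1(\Omega^\varepsilon):u=0\text{ on }\Gamma^{\mathrm{ext}}\}$, and $C_p>0$ is a constant independent of $\varepsilon$ with $\|u\|^2_{L^2(\Omega^\varepsilon)}\le C_p\|\nabla u\|^2_{L^2(\Omega^\varepsilon)}$ for all $u\in V^\varepsilon$ (such a constant exists). Degenerate function. A function $F:\mathbb{R}\to\mathbb{R}$ is degenerate at $x_0\in\mathbb{R}$ if there is $\delta_1>0$ with $0\le F'(x)\le\delta_1$ for a.e. $x\in\mathbb{R}$ and: (i) if $\lim_{x\to s^+}F'(x)\lim_{x\to s^-}F'(x)=0$ for some $s\in\mathbb{R}$, then $s=x_0$; (ii) there exist $\delta_0,r_{x_0}>0$ with $0<\delta_0\le F'(x)\le\delta_1$ for a.e. $x\in\mathbb{R}\setminus\mathcal{B}(x_0,r_{x_0})$, where $\mathcal{B}(x_0,r_{x_0})$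 is the ball of center $x_0$ and radius $r_{x_0}$; (iii) $F'$ is non-decreasing on $\overline{\mathcal{B}(x_0,r_{x_0})}$. Regularization. For such $F$ (with constants $\delta_0,\delta_1$) and $\gamma>0$, a regularization $F_\gamma:\mathbb{R}\to\mathbb{R}$ of $F$ satisfies $0<\gamma\delta_0\le F_\gamma'(x)\le\delta_1$ and $|F(x)-F_\gamma(x)|\le C\gamma^\sigma$ for all $x\in\mathbb{R}$, where $\sigma>0$ and $C>0$ do not depend on $\gamma$ or $x$. Existence of such regularizations of $\mathcal{R}$ is assumed. Assumptions. $(\mathrm{A}_1)$ $\mathbf{A}=(a_{ij}):Y\to\mathbb{R}^{d\times d}$ is essentially bounded, $Y$-periodic, symmetric, globally Lipschitz, and there are $\varepsilon$-independent $\underline\gamma,\overline\gamma>0$ with $\underline\gamma|\xi|^2\le\sum_{i,j}a_{ij}(x/\varepsilon)\xi_i\xi_j\le\overline\gamma|\xi|^2$ for all $\xi\in\mathbb{R}^d$. $(\mathrm{A}_2)$ $\mathcal{R}:\mathbb{R}\to\mathbb{R}$ is degenerate at some point, with constants $\delta_0,\delta_1$. $(\mathrm{A}_3)$ $f\in L^2(\Omega)$. Homogenized coefficient. For $1\le i\le d$, the cell function $\chi_i\in H^1(Y_l)$ is the $Y$-periodic, zero-mean weak solution of $\nabla_y\cdot(-\mathbf{A}(y)(\nabla_y\chi_i+e_i))=0$ in $Y_l$, $-\mathbf{A}(y)(\nabla_y\chi_i+e_i)\cdot n=0$ on $\Gamma$, with $e_i$ the $i$-th unit vector. The constant matrix $A^0=(a^0_{ij})$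 is $a^0_{ij}=\int_{Y_l}\sum_{m=1}^d a_{im}(y)\left(\partial_{y_m}\chi_j(y)+\delta_{mj}\right)dy$, with $\delta_{mj}$ the Kronecker delta. $A^0$ is uniformly elliptic, and $|A^0|>0$ denotes its ellipticity constant: $A^0\xi\cdot\xi\ge|A^0||\xi|^2$ for all $\xi\in\mathbb{R}^d$. Macroscopic iteration. $u_0^0=0$, and for $k\ge1$, $u_0^k\in H^1_0(\Omega)$ is the unique weak solution in $\Omega$, with $u_0^k=0$ on $\partial\Omega$, of: if $\alpha>0$, $$\nabla\cdot(-A^0\nabla u_0^k)+\eta|Y_l|u_0^k=|Y_l|f+\eta|Y_l|u_0^{k-1};$$ if $\alpha=0$, $$\nabla\cdot(-A^0\nabla u_0^k)+(\eta+\delta_1)|Y_l|u_0^k=|Y_l|f+(\eta+\delta_1)|Y_l|u_0^{k-1}-|Y_l|\mathcal{R}_{\gamma_k}(u_0^{k-1}).$$ *)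

(* Defs.v *)
From HB Require Import structures.
From mathcomp Require Import all_boot all_order all_algebra.
From mathcomp Require Import all_classical all_reals all_analysis.

Set Implicit Arguments.
Unset Strict Implicit.
Unset Printing Implicit Defensive.

Import Order.TTheory GRing.Theory Num.Theory.
Import numFieldNormedType.Exports.

Local Open Scope classical_set_scope.
Local Open Scope ring_scope.

(* R^d is 'rV[R]_d.  Its sigma-algebra is generated by the coordinates, as for
   n.-tuple R; since R is second countable this is the Borel sigma-algebra. *)
Definition rV_display : measure_display -> measure_display.
Proof. exact. Qed.

Section measurable_rV.
Context (R : realType) (n : nat).

Let coords : 'I_n -> 'rV[R]_n -> measurableTypeR R := fun i x => x ord0 i.

Let rV_set0 : g_sigma_preimage coords set0.
Proof. exact: sigma_algebra0. Qed.

Let rV_setC A : g_sigma_preimage coords A -> g_sigma_preimage coords (~` A).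
Proof. exact: sigma_algebraC. Qed.

Let rV_bigcup (F : _^nat) : (forall i, g_sigma_preimage coords (F i)) ->
  g_sigma_preimage coords (\bigcup_i (F i)).
Proof. exact: sigma_algebra_bigcup. Qed.

HB.instance Definition _ := @isMeasurable.Build (rV_display default_measure_display)
  'rV[R]_n (g_sigma_preimage coords) rV_set0 rV_setC rV_bigcup.

End measurable_rV.

Section lebesgue_rV.
Context (R : realType).

Definition cons_rV n (p : measurableTypeR R * 'rV[R]_n) : 'rV[R]_n.+1 :=
  row_mx (const_mx p.1 : 'rV_1) p.2.

Lemma measurable_coord n (i : 'I_n) :
  measurable_fun [set: 'rV[R]_n] (fun x => x ord0 i : measurableTypeR R).
Proof.
move=> _ Y mY; rewrite setTI; apply: sub_sigma_algebra => /=.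
rewrite -bigcup_seq/=; exists i => /=; first by rewrite mem_index_enum.
by exists Y => //; rewrite setTI.
Qed.

Lemma measurable_rVP d (T : measurableType d) n (f : T -> 'rV[R]_n) :
  (forall i, measurable_fun setT (fun t => f t ord0 i : measurableTypeR R)) ->
  measurable_fun setT f.
Proof.
move=> mf _ Y mY; rewrite setTI.
have sF : sigma_algebra setT [set B : set 'rV[R]_n | measurable (f @^-1` B)].
  split=> /=.
  - by rewrite preimage_set0.
  - by move=> A mA; rewrite setTD preimage_setC; exact: measurableC.
  - by move=> F mF; rewrite preimage_bigcup; exact: bigcup_measurable.
apply: (mY [set B | measurable (f @^-1` B)]); split => // B.
rewrite -bigcup_seq/= => -[i _ [Z mZ <-]] /=; rewrite setTI.
by have := mf i measurableT Z mZ; rewrite setTI.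
Qed.

Lemma measurable_cons_rV n : measurable_fun setT (@cons_rV n).
Proof.
apply: measurable_rVP => i; case: (split_ordP (i : 'I_(1 + n))) => j ->.
  rewrite (_ : (fun _ => _) = fst); first exact: measurable_fst.
  by apply/funext => -[x y]; rewrite [LHS]row_mxEl mxE.
rewrite (_ : (fun _ => _) = (fun x : 'rV[R]_n => x ord0 j) \o snd).
  apply: measurableT_comp; [exact: measurable_coord|exact: measurable_snd].
by apply/funext => -[x y]; exact: row_mxEr.
Qed.

Section step.
Context n (m : {sigma_finite_measure set 'rV[R]_n -> \bar R}).

Definition lebesgue_cons : set 'rV[R]_n.+1 -> \bar R :=
  pushforward (@lebesgue_measure R \x m)%E (@cons_rV n).

Let pushed : {measure set 'rV[R]_n.+1 -> \bar R} :=
  measure_function_pushforward__canonical__measure_function_Measure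
    (@lebesgue_measure R \x m)%E (@measurable_cons_rV n).

Let lebesgue_cons0 : lebesgue_cons set0 = 0%E.
Proof. exact: (measure0 pushed). Qed.

Let lebesgue_cons_ge0 A : (0 <= lebesgue_cons A)%E.
Proof. exact: (measure_ge0 pushed). Qed.

Let lebesgue_cons_sigma_additive : semi_sigma_additive lebesgue_cons.
Proof. exact: (@measure_semi_sigma_additive _ _ _ pushed). Qed.

HB.instance Definition _ := isMeasure.Build _ _ _ lebesgue_cons
  lebesgue_cons0 lebesgue_cons_ge0 lebesgue_cons_sigma_additive.

Let lebesgue_cons_sigma_finite : sigma_finite setT lebesgue_cons.
Proof.
have /sigma_finiteP[F [FT ndF Foo]] := sigma_finiteT (@lebesgue_measure R).
have /sigma_finiteP[G [GT ndG Goo]] := sigma_finiteT m.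
pose uncons (x : 'rV[R]_n.+1) : measurableTypeR R * 'rV[R]_n :=
  (x ord0 ord0, \row_j x ord0 (lift ord0 j)).
have consK : cancel (@cons_rV n) uncons.
  move=> [x y]; congr pair.
    transitivity ((row_mx (const_mx x : 'rV_1) y) ord0 (lshift n ord0)).
      by congr (row_mx _ _ _ _); exact/val_inj.
    by rewrite row_mxEl mxE.
  apply/rowP => j; rewrite mxE.
  transitivity ((row_mx (const_mx x : 'rV_1) y) ord0 (rshift 1 j)).
    by congr (row_mx _ _ _ _); exact/val_inj.
  by rewrite row_mxEr.
have muncons : measurable_fun setT uncons.
  apply: measurable_fun_pair; first exact: measurable_coord.
  apply: measurable_rVP => i.
  rewrite (_ : (fun _ => _) = fun x : 'rV[R]_n.+1 => x ord0 (lift ord0 i)).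
    exact: measurable_coord.
  by apply/funext => x; rewrite /= mxE.
exists (fun k => uncons @^-1` (F k `*` G k)).
  rewrite -preimage_bigcup (_ : \bigcup_k _ = setT) ?preimage_setT//.
  apply/seteqP; split => // -[x y] _.
  have [k _ Fkx] : (\bigcup_k F k) x by rewrite -FT.
  have [l _ Gly] : (\bigcup_k G k) y by rewrite -GT.
  exists (maxn k l) => //; split => /=.
    by move: x Fkx; exact/subsetPset/ndF/leq_maxl.
  by move: y Gly; exact/subsetPset/ndG/leq_maxr.
move=> k; have [mF Fk] := Foo k; have [mG Gk] := Goo k; split.
  by rewrite -[X in measurable X]setTI; apply: muncons => //; exact: measurableX.
rewrite /lebesgue_cons /pushforward -comp_preimage.
rewrite (_ : uncons \o _ = id) ?preimage_id; last exact/funext.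
by rewrite product_measure1E// lte_mul_pinfty// ge0_fin_numE.
Qed.

HB.instance Definition _ :=
  Measure_isSigmaFinite.Build _ _ _ lebesgue_cons lebesgue_cons_sigma_finite.

End step.

Fixpoint lebesgue_rV n : {sigma_finite_measure set 'rV[R]_n -> \bar R} :=
  match n with
  | 0 => \d_(0 : 'rV[R]_0)
  | n'.+1 => lebesgue_cons (lebesgue_rV n')
  end.

End lebesgue_rV.

Section vector_calculus.
Context (R : realType) (d : nat).
Implicit Types (u phi : 'rV[R]_d -> R) (x y : 'rV[R]_d).

Definition dotv x y : R := \sum_(i < d) x ord0 i * y ord0 i.

(* vectors are rows, so the matrix-vector product A x reads x *m A^T *)
Definition mxapp (A : 'M[R]_d) x : 'rV[R]_d := x *m A^T.

Definition unitv (i : 'I_d) : 'rV[R]_d := delta_mx ord0 i.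

Definition partial (i : 'I_d) phi : 'rV[R]_d -> R := fun x => 'D_(unitv i) phi x.

Definition grad phi : 'rV[R]_d -> 'rV[R]_d := fun x => \row_i partial i phi x.

Definition smooth phi :=
  forall (s : seq 'I_d) x, differentiable (foldr partial phi s) x.

Definition support phi : set 'rV[R]_d := closure [set x | phi x != 0].

(* C_c^oo(O) *)
Definition test_function (O : set 'rV[R]_d) phi :=
  [/\ smooth phi, compact (support phi) & support phi `<=` O].

End vector_calculus.

Section geometry.
Context (R : realType) (d : nat).
Implicit Types (D B : set 'rV[R]_d).

Definition boundary D : set 'rV[R]_d := closure D `\` interior D.

Definition domain D := [/\ open D, D !=set0 & connected D].

(* In a neighbourhood of each boundary point p, the open set D lies strictly
   below the graph of a Lipschitz function over the hyperplane orthogonal to nu.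
   That function is encoded by its extension h, constant along nu. *)
Definition lipschitz_boundary D := forall p, boundary D p ->
  exists (nu : 'rV[R]_d) (h : 'rV[R]_d -> R) (L r : R),
    [/\ dotv nu nu = 1,
        forall x t, h (x + t *: nu) = h x,
        forall x y, `|h x - h y| <= L * `|x - y|,
        0 < r
      & forall x, ball p r x -> (D x <-> dotv nu x < h x)].

(* intersection of the closed half-spaces n . x <= c, for (n, c) in s *)
Definition convex_polyhedron (s : seq ('rV[R]_d * R)) : set 'rV[R]_d :=
  [set x | forall c, c \in s -> dotv c.1 x <= c.2].

Definition polyhedral_domain D :=
  [/\ domain D, bounded_set D
    & exists P : seq (seq ('rV[R]_d * R)),
        D = interior (\bigcup_(s in [set` P]) convex_polyhedron s)].

Definition lattice (k : 'rV[int]_d) : 'rV[R]_d := map_mx intr k.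

Definition periodic (T : Type) (f : 'rV[R]_d -> T) :=
  forall k y, f (y + lattice k) = f y.

Definition cell : set 'rV[R]_d := [set y | forall i, 0 <= y ord0 i <= 1].

(* Below, B is the open hole, so that Y_l = Y \ closure B and Gamma = boundary B. *)
Definition pore B : set 'rV[R]_d := cell `\` closure B.

Definition pore_periodic B : set 'rV[R]_d :=
  ~` \bigcup_k [set y + lattice k | y in closure B].

Definition perforated_cell B :=
  [/\ open B, B !=set0, closure B `<=` cell, lipschitz_boundary B
    & domain (pore_periodic B)].

Definition scaled_copy (e : R) (k : 'rV[int]_d) D : set 'rV[R]_d :=
  [set e *: (y + lattice k) | y in D].

(* the copies of the hole that are removed from D are those contained in D *)
Definition removed D B (e : R) : set 'rV[int]_d :=
  [set k | scaled_copy e k (closure B) `<=` D].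

Definition perforated D B (e : R) : set 'rV[R]_d :=
  D `\` \bigcup_(k in removed D B e) scaled_copy e k (closure B).

Definition Gamma_eps D B (e : R) : set 'rV[R]_d :=
  \bigcup_(k in removed D B e) scaled_copy e k (boundary B).

Definition admissible_perforation D B (e : R) :=
  [/\ domain (perforated D B e), bounded_set (perforated D B e),
      lipschitz_boundary (perforated D B e)
    & boundary (perforated D B e) = Gamma_eps D B e `|` boundary D].

End geometry.

(* An element of a Sobolev space is handled as a pair (u, g) of a function and
   (a representative of) its weak gradient, the latter being determined by u up
   to a null set. *)
Section sobolev.
Context (R : realType) (d : nat).
Local Notation mu := (lebesgue_rV R d).
Implicit Types (D O : set 'rV[R]_d) (u v : 'rV[R]_d -> R)
  (g h : 'rV[R]_d -> 'rV[R]_d).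

Definition L2 D u :=
  measurable_fun D u /\ mu.-integrable D (fun x => (u x ^+ 2)%:E).

Definition L2v D g := forall i, L2 D (fun x => g x ord0 i).

Definition L2norm D u : R := Num.sqrt (\int[mu]_(x in D) (u x ^+ 2)).

Definition L2normv D g : R := Num.sqrt (\int[mu]_(x in D) dotv (g x) (g x)).

Definition weak_gradient D u g := forall phi, test_function D phi ->
  forall i, \int[mu]_(x in D) (u x * partial i phi x) =
            - \int[mu]_(x in D) (g x ord0 i * phi x).

Definition H1 D u g := [/\ L2 D u, L2v D g & weak_gradient D u g].

Definition H1norm D u g : R :=
  Num.sqrt (L2norm D u ^+ 2 + L2normv D g ^+ 2).

(* closure in H^1(D) of the restrictions to D of the functions of C_c^oo(O) *)
Definition H1_closure O D u g := H1 D u g /\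
  exists phi : nat -> 'rV[R]_d -> R,
    (forall n, test_function O (phi n)) /\
    H1norm D (fun x => phi n x - u x) (fun x => grad (phi n) x - g x)
      @[n --> \oo] --> (0 : R).

Definition H10 D u g := H1_closure D D u g.

(* The approximating functions vanish near the boundary of D but are arbitrary
   near Gamma_eps: the trace of u vanishes on the boundary of D only. *)
Definition V_eps D B (e : R) u g := H1_closure D (perforated D B e) u g.

(* Y-periodic functions of H^1(Y_l): the weak gradient is taken across the
   faces of the cell, in the periodic extension of Y_l *)
Definition H1_per B u g :=
  [/\ periodic u, periodic g, L2 (pore B) u, L2v (pore B) g
    & weak_gradient (pore_periodic B) u g].

Definition cauchy_H10 D (u : nat -> 'rV[R]_d -> R)
    (g : nat -> 'rV[R]_d -> 'rV[R]_d) :=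
  (forall k, H10 D (u k) (g k)) /\
  forall e : R, 0 < e -> exists N, forall m n, (N <= m)%N -> (N <= n)%N ->
    H1norm D (fun x => u m x - u n x) (fun x => g m x - g n x) < e.

End sobolev.

Section nonlinearity.
Context (R : realType).
Implicit Types (F G : R -> R).

(* F' is considered on the set of full measure where F is differentiable *)
Definition degenerate_at F (x0 delta0 delta1 : R) :=
  let F_diff := [set x | derivable F x 1] in
  [/\ 0 < delta1,
      {ae @lebesgue_measure R, forall x, F_diff x /\ 0 <= derive1 F x <= delta1},
      forall s lr ll : R,
        derive1 F @ within F_diff s^'+ --> lr ->
        derive1 F @ within F_diff s^'- --> ll -> lr * ll = 0 -> s = x0,
      0 < delta0
    & exists r : R, [/\ 0 < r,
        {ae @lebesgue_measure R, forall x, ~ ball x0 r x ->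
          delta0 <= derive1 F x <= delta1}
      & forall x y, closed_ball x0 r x -> closed_ball x0 r y ->
          F_diff x -> F_diff y -> x <= y -> derive1 F x <= derive1 F y]].

Definition regularization F (delta0 delta1 C sigma gamma : R) G :=
  forall x, [/\ derivable G x 1, 0 < gamma * delta0,
    gamma * delta0 <= derive1 G x <= delta1 & `|F x - G x| <= C * gamma `^ sigma].

End nonlinearity.

Section homogenization.
Context (R : realType) (d : nat).
Local Notation mu := (lebesgue_rV R d).
Implicit Types (B D : set 'rV[R]_d) (A : 'rV[R]_d -> 'M[R]_d).

(* A stands for the Y-periodic extension to R^d of the coefficient *)
Definition admissible_coefficient A (gamma_lo gamma_up : R) :=
  [/\ exists K : R, {ae mu, forall y, forall i j, `|A y i j| <= K},
      periodic A,
      forall y, (A y)^T = A y,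
      exists L : R, forall y z, `|A y - A z| <= L * `|y - z|
    & [/\ 0 < gamma_lo, 0 < gamma_up
      & forall e : R, 0 < e < 1 -> forall x xi,
          gamma_lo * dotv xi xi <= dotv (mxapp (A (e^-1 *: x)) xi) xi
                          <= gamma_up * dotv xi xi]].

Definition cell_function A B (i : 'I_d) (chi : 'rV[R]_d -> R)
    (gchi : 'rV[R]_d -> 'rV[R]_d) :=
  [/\ H1_per B chi gchi,
      \int[mu]_(y in pore B) chi y = 0
    & forall v h, H1_per B v h ->
        \int[mu]_(y in pore B)
          dotv (mxapp (A y) (gchi y + unitv R i)) (h y) = 0].

Definition homogenized A B (gchi : 'I_d -> 'rV[R]_d -> 'rV[R]_d) : 'M[R]_d :=
  \matrix_(i, j) \int[mu]_(y in pore B)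
    \sum_(m < d) A y i m * (gchi j y ord0 m + (m == j)%:R).

Definition poreVol B : R := fine (mu (pore B)).

(* (u, g) is a weak solution of div (- A0 grad u) + c u = rhs in D, u = 0 on
   the boundary of D *)
Definition macro_weak_solution (A0 : 'M[R]_d) D (c : R) (rhs : 'rV[R]_d -> R)
    (u : 'rV[R]_d -> R) (g : 'rV[R]_d -> 'rV[R]_d) :=
  H10 D u g /\ forall v h, H10 D v h ->
    \int[mu]_(x in D) dotv (mxapp A0 (g x)) (h x)
    + c * (\int[mu]_(x in D) (u x * v x)) = \int[mu]_(x in D) (rhs x * v x).

Definition macro_iteration (A0 : 'M[R]_d) D (Yl alpha eta delta1 : R)
    (f : 'rV[R]_d -> R) (gamma : nat -> R) (Rg : R -> R -> R)
    (u : nat -> 'rV[R]_d -> R) (g : nat -> 'rV[R]_d -> 'rV[R]_d) :=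
  (forall x, u 0%N x = 0) /\
  forall k, (1 <= k)%N ->
    (0 < alpha -> macro_weak_solution A0 D (eta * Yl)
       (fun x => Yl * f x + eta * Yl * u k.-1 x) (u k) (g k)) /\
    (alpha = 0 -> macro_weak_solution A0 D ((eta + delta1) * Yl)
       (fun x => Yl * f x + (eta + delta1) * Yl * u k.-1 x
                 - Yl * Rg (gamma k) (u k.-1 x)) (u k) (g k)).

End homogenization.

(* Main.v *)
(** Set [w_k = u_{k+1} - u_k] and let [c] be the zeroth-order coefficient of the
    scheme.  Testing the difference of two consecutive weak formulations with
    [w_k], ellipticity and the Poincare inequality give
    [(a0 / cp + c) |w_{k+1}| <= |r_{k+1} - r_k|] in [L^2], where [r_k] is the right-hand
    side.  Since [0 <= R_gamma' <= delta1], the map [s |-> (eta + delta1) s - R_gamma s]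
    is [(eta + delta1)]-Lipschitz, so [|r_{k+1} - r_k| <= c |w_k| + E omega ^ k]; the
    last term, absent for [alpha > 0], pays for replacing [R_{gamma_k}] by
    [R_{gamma_{k+1}}], since [gamma_k ^ sigma <= C omega ^ (k+1) gamma_{k+1}].  As
    [c / (a0 / cp + c) < 1], the norms [|w_k|] decay geometrically, and the same energy
    estimate transfers the decay to the gradients. *)

Require Import Defs.
From HB Require Import structures.
From mathcomp Require Import all_boot all_order all_algebra.
From mathcomp Require Import all_classical all_reals all_analysis.
From mathcomp Require Import measurable_realfun ring lra.

Import Order.TTheory GRing.Theory Num.Theory.
Import numFieldNormedType.Exports.

Local Open Scope classical_set_scope.
Local Open Scope ring_scope.

Set Implicit Arguments.
Unset Strict Implicit.
Unset Printing Implicit Defensive.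

(** * Lebesgue measure on R^d *)

Section measure_rV.
Context {R : realType} {n : nat}.
Implicit Types (O : set 'rV[R]_n) (f : 'rV[R]_n -> R).

Lemma open_measurable_rV O : open O -> measurable O.
Proof.
move=> oO.
pose box (p : 'rV[rat]_n * 'rV[rat]_n) : set 'rV[R]_n :=
  [set x | forall i, ratr (p.1 ord0 i) < x ord0 i < ratr (p.2 ord0 i)].
have mbox p : measurable (box p).
  rewrite (_ : box p = \bigcap_(i in [set: 'I_n])
    ((fun x : 'rV[R]_n => x ord0 i : measurableTypeR R) @^-1`
       [set` `]ratr (p.1 ord0 i), ratr (p.2 ord0 i)[%R])); last first.
    apply/seteqP; split => [x xp i _ | x xp i] /=.
      by rewrite in_itv; exact: xp.
    by have := xp i I; rewrite /= in_itv.
  apply: fin_bigcap_measurable => // i _.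
  by rewrite -[X in measurable X]setTI; apply: (measurable_coord i).
rewrite (_ : O = \bigcup_p (if `[< box p `<=` O >] then box p else set0)).
  apply: countable_bigcupT_measurable => // p.
  by case: ifP.
apply/seteqP; split => [x Ox|x [p _]]; last first.
  by case: ifPn => // /asboolP pO /pO.
have /nbhs_ballP[e /= e0 xeO] : nbhs x O by exact: open_nbhs_nbhs.
have ha i : {q : rat | x ord0 i - e < ratr q < x ord0 i}.
  apply: cid; have /rat_in_itvoo[q] : x ord0 i - e < x ord0 i by rewrite gtrBl.
  by rewrite in_itv; exists q.
have hb i : {q : rat | x ord0 i < ratr q < x ord0 i + e}.
  apply: cid; have /rat_in_itvoo[q] : x ord0 i < x ord0 i + e by rewrite ltrDl.
  by rewrite in_itv; exists q.
exists (\row_i sval (ha i), \row_i sval (hb i)) => //.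
rewrite ifT; last first.
  apply/asboolP => y yab; apply: xeO; split => // i j.
  rewrite ord1; have := yab j; rewrite /= !mxE.
  case: (ha j) (hb j) => /= a /andP[a1 a2] [b /= /andP[b1 b2]] /andP[y1 y2].
  by rewrite /ball /= ltr_norml; apply/andP; split; lra.
move=> i /=; rewrite !mxE; case: (ha i) (hb i) => /= a /andP[a1 a2] [b /= /andP[b1 b2]].
by rewrite a2 b1.
Qed.

Lemma continuous_measurable_rV f : continuous f -> measurable_fun setT f.
Proof.
move=> cf; apply: (measurability _ (RGenOInfty.measurableE R)).
move=> _ [_ [a ->] <-]; rewrite setTI; apply: open_measurable_rV.
by apply: open_comp => //; exact: interval_open.
Qed.

End measure_rV.

Lemma measurable_box (R : realType) m (r : R) :
  measurable [set x : 'rV[R]_m | forall i, `|x ord0 i| <= r].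
Proof.
rewrite (_ : [set _ | _] = \bigcap_(i in [set: 'I_m])
  ((fun x : 'rV[R]_m => x ord0 i : measurableTypeR R) @^-1`
     [set` `[- r, r]%R])); last first.
  apply/seteqP; split => [x xp i _ | x xp i] /=.
    by rewrite in_itv/= -ler_norml.
  by have := xp i I; rewrite /= in_itv/= -ler_norml.
apply: fin_bigcap_measurable => // i _; rewrite -[X in measurable X]setTI.
by apply: (measurable_coord i).
Qed.

Lemma cons_rVEl (R : realType) n (p : measurableTypeR R * 'rV[R]_n) (j : 'I_1) :
  cons_rV p ord0 (lshift n j) = p.1.
Proof. by rewrite [LHS]row_mxEl mxE. Qed.

Lemma cons_rVEr (R : realType) n (p : measurableTypeR R * 'rV[R]_n) (j : 'I_n) :
  cons_rV p ord0 (rshift 1 j) = p.2 ord0 j.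
Proof. exact: row_mxEr. Qed.

Lemma lebesgue_rV_box (R : realType) n (r : R) :
  (lebesgue_rV R n [set x | forall i, (`|x ord0 i| <= r)%R] < +oo)%E.
Proof.
elim: n => [|n IH].
  by rewrite /= /dirac indicE; case: (_ \in _); rewrite ltry.
rewrite /= /lebesgue_cons /pushforward.
rewrite (_ : _ @^-1` _ = [set` `[- r, r]%R] `*`
    [set x : 'rV[R]_n | forall i, (`|x ord0 i| <= r)%R]); last first.
  apply/seteqP; split => [p /= h|p /= [hx hy] i].
    split=> [|i].
      by have := h (lshift n (@ord0 0)); rewrite cons_rVEl in_itv/= -ler_norml.
    by have := h (rshift 1 i); rewrite cons_rVEr.
  move: hx; rewrite in_itv/= -ler_norml => hx.
  by case: (split_ordP (i : 'I_(1 + n))) => j ->; rewrite ?cons_rVEl ?cons_rVEr.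
rewrite product_measure1E//; last exact: measurable_box.
apply: lte_mul_pinfty => //.
  suff : @lebesgue_measure R `[- r, r] \is a fin_num by [].
  rewrite lebesgue_measure_itv /=.
  by case: ifP.
Qed.

Lemma bounded_lebesgue_rV (R : realType) n (D : set 'rV[R]_n) :
  measurable D -> bounded_set D -> (lebesgue_rV R n D < +oo)%E.
Proof.
move=> mD /ex_strict_bound_gt0[r r0 Dr].
apply: le_lt_trans (lebesgue_rV_box n r); apply: le_measure; rewrite ?inE//.
  exact: measurable_box.
move=> x /Dr /= /ltW xr i; apply: le_trans xr.
rewrite {2}/Num.norm /= mx_normrE; exact: (le_bigmax _ _ (ord0, i)).
Qed.

(** * Square-integrable functions *)

Section L2_theory.
Context {R : realType} {d : nat} {D : set 'rV[R]_d} (mD : measurable D).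
Local Notation mu := (lebesgue_rV R d).
Implicit Types u v : 'rV[R]_d -> R.

Lemma L2_le u v : measurable_fun D u -> L2 D v ->
  (forall x, D x -> `|u x| <= `|v x|) -> L2 D u.
Proof.
move=> mu_ [_ iv] uv; split => //; apply: le_integrable iv => //.
  by apply/measurable_EFinP; exact: measurable_funX.
by move=> x Dx /=; rewrite lee_fin !normrX lerXn2r ?nnegrE ?uv.
Qed.

Lemma L2_integrableM u v : L2 D u -> L2 D v ->
  mu.-integrable D (EFin \o (fun x => u x * v x)).
Proof.
move=> [mu_ iu] [mv iv]; apply: le_integrable (integrableD mD iu iv) => //.
  by apply/measurable_EFinP; exact: measurable_funM.
move=> x Dx /=; rewrite lee_fin [leRHS]ger0_norm ?addr_ge0 ?sqr_ge0// ler_norml.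
by apply/andP; split; nra.
Qed.

Lemma L2D u v : L2 D u -> L2 D v -> L2 D (fun x => u x + v x).
Proof.
move=> Lu Lv; have iuv := L2_integrableM Lu Lv.
case: Lu Lv => mu_ iu [mv iv]; split; first exact: measurable_funD.
apply: (eq_integrable _ (fun x => (u x ^+ 2)%:E + (v x ^+ 2)%:E + 2%:E * (u x * v x)%:E)%E) => //.
  by move=> x _; rewrite -EFinM -!EFinD; congr EFin; ring.
by apply: integrableD => //; [exact: integrableD | exact: integrableZl].
Qed.

Lemma L2Z a u : L2 D u -> L2 D (fun x => a * u x).
Proof.
move=> [mu_ iu]; split; first exact: measurable_funM.
apply: (eq_integrable _ (fun x => (a ^+ 2)%:E * (u x ^+ 2)%:E)%E) => //.
  by move=> x _; rewrite -EFinM exprMn.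
exact: integrableZl.
Qed.

Lemma L2B u v : L2 D u -> L2 D v -> L2 D (fun x => u x - v x).
Proof.
move=> Lu Lv; under eq_fun do rewrite -mulN1r; apply: L2D => //; exact: L2Z.
Qed.

Lemma L2_cst a : (mu D < +oo)%E -> L2 D (cst a).
Proof.
move=> Doo; split; first exact: measurable_cst.
apply/integrableP; split; first by apply/measurable_EFinP; exact: measurable_funX.
by rewrite /= (integral_cst _ mD) lte_mul_pinfty.
Qed.

Lemma L2norm_sqr u : L2norm D u ^+ 2 = \int[mu]_(x in D) (u x ^+ 2).
Proof. by rewrite sqr_sqrtr// Rintegral_ge0// => x _; exact: sqr_ge0. Qed.

Lemma L2norm_ge0 u : 0 <= L2norm D u. Proof. exact: sqrtr_ge0. Qed.

Lemma L2norm_sqrB u v t : L2 D u -> L2 D v ->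
  L2norm D (fun x => u x - t * v x) ^+ 2 = L2norm D u ^+ 2
    - 2 * t * (\int[mu]_(x in D) (u x * v x)) + t ^+ 2 * L2norm D v ^+ 2.
Proof.
move=> Lu Lv; have iuv := L2_integrableM Lu Lv.
have iu2 : mu.-integrable D (EFin \o (fun x => u x ^+ 2)) by case: Lu.
have iv2 : mu.-integrable D (EFin \o (fun x => v x ^+ 2)) by case: Lv.
have iz (w : 'rV[R]_d -> R) a : mu.-integrable D (EFin \o w) ->
    mu.-integrable D (EFin \o (fun x => a * w x)).
  by move=> iw; apply: (eq_integrable _ (fun x => a%:E * (w x)%:E)%E) => //; exact: integrableZl.
rewrite !L2norm_sqr -!RintegralZl// -RintegralB//; last exact: iz.
rewrite -RintegralD//; last exact: iz.
  by apply: eq_Rintegral => x _; ring.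
by apply: (eq_integrable _
    ((fun x => (u x ^+ 2)%:E) \- (fun x => (2 * t * (u x * v x))%:E))%E) => //;
  apply: integrableB => //; exact: iz.
Qed.

Lemma L2_cauchy_schwarz u v : L2 D u -> L2 D v ->
  \int[mu]_(x in D) (u x * v x) <= L2norm D u * L2norm D v.
Proof.
move=> Lu Lv; set b := (X in X <= _).
have P t : 0 <= L2norm D u ^+ 2 - 2 * t * b + t ^+ 2 * L2norm D v ^+ 2.
  by rewrite -L2norm_sqrB// sqr_ge0.
have := L2norm_ge0 u; have := L2norm_ge0 v.
set a := L2norm D u in P *; set c := L2norm D v in P * => c0 a0.
rewrite leNgt; apply/negP => acb.
have b0 : 0 < b by apply: le_lt_trans acb; exact: mulr_ge0.
move: c0; rewrite le_eqVlt => /predU1P[c0|c0].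
  have := P ((a ^+ 2 + 1) / b); rewrite -c0 expr0n mulr0 addr0.
  rewrite -!mulrA mulVf ?gt_eqF// mulr1; nra.
have := P (b / c ^+ 2).
rewrite (_ : _ - _ + _ = (a ^+ 2 * c ^+ 2 - b ^+ 2) / c ^+ 2); last first.
  by field; rewrite gt_eqF.
rewrite pmulr_lge0 ?invr_gt0 ?exprn_gt0// subr_ge0 -exprMn.
by rewrite ler_pXn2r ?nnegrE ?mulr_ge0 ?(ltW b0) ?(ltW c0)// leNgt acb.
Qed.

Lemma L2norm_triangle u v : L2 D u -> L2 D v ->
  L2norm D (fun x => u x + v x) <= L2norm D u + L2norm D v.
Proof.
move=> Lu Lv; have := L2_cauchy_schwarz Lu Lv.
have := L2norm_sqrB (-1) Lu Lv.
rewrite (_ : (fun x => u x - -1 * v x) = (fun x => u x + v x)); last first.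
  by apply/funext => x; ring.
have := L2norm_ge0 u; have := L2norm_ge0 v; have := L2norm_ge0 (fun x => u x + v x).
by move=> *; rewrite -ler_sqr ?nnegrE ?addr_ge0//; nra.
Qed.

Lemma L2normZ a u : L2 D u -> L2norm D (fun x => a * u x) = `|a| * L2norm D u.
Proof.
move=> [_ iu]; rewrite /L2norm -sqrtr_sqr -sqrtrM ?sqr_ge0// -RintegralZl//.
by congr Num.sqrt; apply: eq_Rintegral => x _; rewrite exprMn.
Qed.

Lemma L2norm_cst a : L2norm D (cst a) = `|a| * L2norm D (cst 1).
Proof.
rewrite /L2norm -sqrtr_sqr -sqrtrM ?sqr_ge0// /= !(Rintegral_cst _ mD).
by rewrite expr1n mul1r.
Qed.

Lemma L2normBC u v : L2norm D (fun x => u x - v x) = L2norm D (fun x => v x - u x).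
Proof. by congr Num.sqrt; apply: eq_Rintegral => x _; rewrite -sqrrN opprB. Qed.

Lemma le_L2norm u v : L2 D u -> L2 D v -> (forall x, D x -> `|u x| <= `|v x|) ->
  L2norm D u <= L2norm D v.
Proof.
move=> [_ iu] [_ iv] uv; rewrite ler_sqrt; last first.
  by rewrite Rintegral_ge0// => x _; exact: sqr_ge0.
apply: le_Rintegral => // x Dx.
by rewrite -real_normK ?num_real// -[leRHS]real_normK ?num_real// lerXn2r ?nnegrE ?uv.
Qed.

End L2_theory.

(** * Test functions and vector fields *)

Lemma sum_sqr_le (R : realDomainType) (I : Type) (s : seq I) (F : I -> R) :
  (forall i, 0 <= F i) -> \sum_(i <- s) F i ^+ 2 <= (\sum_(i <- s) F i) ^+ 2.
Proof.
move=> F0; suff : 0 <= \sum_(i <- s) F i /\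
  \sum_(i <- s) F i ^+ 2 <= (\sum_(i <- s) F i) ^+ 2 by case.
elim/big_rec2: _ => [|i a b _ [a0 ab]]; first by rewrite expr0n.
by have Fi0 := F0 i; split; nra.
Qed.

Lemma Rintegral_sum d (T : measurableType d) (R : realType)
    (mu : {measure set T -> \bar R}) (D : set T) (I : Type) (s : seq I) (F : I -> T -> R) :
  measurable D -> (forall i, mu.-integrable D (EFin \o F i)) ->
  \int[mu]_(x in D) (\sum_(i <- s) F i x) = \sum_(i <- s) \int[mu]_(x in D) F i x.
Proof.
move=> mD iF; elim: s => [|i s IH].
  by under eq_Rintegral do rewrite big_nil; rewrite Rintegral_cst// mul0r big_nil.
under eq_Rintegral do rewrite big_cons.
rewrite RintegralD ?big_cons ?IH//.
apply: (eq_integrable mD (fun x => \sum_(j <- s) (F j x)%:E)%E).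
  by move=> x _; rewrite /= sumEFin.
by apply: integrable_sum => // j _; exact: iF.
Qed.

Section test_functions.
Context {R : realType} {d : nat}.
Implicit Types (O D : set 'rV[R]_d) (phi psi : 'rV[R]_d -> R).

Lemma partialB i phi psi : smooth phi -> smooth psi ->
  partial i (fun x => phi x - psi x) = (fun x => partial i phi x - partial i psi x).
Proof.
move=> sphi spsi; apply/funext => x; rewrite /partial.
by apply: deriveB; apply: diff_derivable; [exact: (sphi [::])|exact: (spsi [::])].
Qed.

Lemma smooth_partial i phi : smooth phi -> smooth (partial i phi).
Proof. by move=> sphi s x; rewrite -foldr_rcons; exact: sphi. Qed.

Lemma foldr_partialB s phi psi : smooth phi -> smooth psi ->
  foldr (@partial R d) (fun x => phi x - psi x) s =
  (fun x => foldr (@partial R d) phi s x - foldr (@partial R d) psi s x).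
Proof.
elim/last_ind: s phi psi => // s i IH phi psi sphi spsi.
by rewrite !foldr_rcons partialB// IH//; exact: smooth_partial.
Qed.

Lemma smoothB phi psi : smooth phi -> smooth psi -> smooth (fun x => phi x - psi x).
Proof.
move=> sphi spsi s x; rewrite foldr_partialB//.
by apply: differentiableB; [exact: sphi|exact: spsi].
Qed.

Lemma gradB phi psi : smooth phi -> smooth psi ->
  grad (fun x => phi x - psi x) = (fun x => grad phi x - grad psi x).
Proof.
by move=> sphi spsi; apply/funext => x; apply/rowP => i; rewrite !mxE partialB.
Qed.

Lemma supportB phi psi :
  Defs.support (fun x => phi x - psi x) `<=` Defs.support phi `|` Defs.support psi.
Proof.
rewrite /Defs.support -closureU; apply: closureS => x /=.
have [->|] := eqVneq (phi x) 0; last by left.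
by rewrite sub0r oppr_eq0; right.
Qed.

Lemma test_functionB O phi psi : test_function O phi -> test_function O psi ->
  test_function O (fun x => phi x - psi x).
Proof.
move=> [sphi cphi Ophi] [spsi cpsi Opsi]; split; first exact: smoothB.
  apply: subclosed_compact (@supportB phi psi); first exact: closed_closure.
  exact: compactU.
by apply: subset_trans (@supportB phi psi) _ => x [/Ophi|/Opsi].
Qed.

Lemma smooth_continuous phi : smooth phi -> continuous phi.
Proof. by move=> sphi x; apply: differentiable_continuous; exact: (sphi [::]). Qed.

Lemma notin_support phi x : ~ Defs.support phi x -> phi x = 0.
Proof.
rewrite /Defs.support => phix; apply: contra_notP phix => /eqP phix0.
exact: (@subset_closure _ [set y | phi y != 0]).
Qed.

Lemma support_partial i phi : Defs.support (partial i phi) `<=` Defs.support phi.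
Proof.
rewrite [X in _ `<=` X](closure_id _).1; last exact: closed_closure.
apply: closureS => x /=; apply: contra_neqP => phix.
rewrite /partial (near_eq_derive (g := cst 0)) ?derive_cst//.
have : nbhs x (~` Defs.support phi).
  by apply: open_nbhs_nbhs; split => //; apply: closed_openC; exact: closed_closure.
by apply: filterS => y; exact: notin_support.
Qed.

Lemma smooth_L2 D phi : measurable D -> (lebesgue_rV R d D < +oo)%E ->
  smooth phi -> compact (Defs.support phi) -> L2 D phi.
Proof.
move=> mD Doo sphi cphi; have cont := smooth_continuous sphi.
have : compact (phi @` Defs.support phi).
  by apply: continuous_compact => //; exact: continuous_subspaceT.
move=> /compact_bounded/ex_strict_bound_gt0[M M0 phiM].
apply: (@L2_le _ _ _ mD _ (cst M)); last first.
- move=> x _ /=; rewrite (gtr0_norm M0).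
  have [xphi|/notin_support ->] := pselect (Defs.support phi x).
    by apply/ltW/phiM; exists x.
  by rewrite normr0 ltW.
- exact: L2_cst.
- by apply: measurable_funS (continuous_measurable_rV cont).
Qed.

End test_functions.

Section vector_L2.
Context {R : realType} {d : nat} {D : set 'rV[R]_d} (mD : measurable D).
Local Notation mu := (lebesgue_rV R d).
Implicit Types (u v : 'rV[R]_d -> R) (g h : 'rV[R]_d -> 'rV[R]_d).

Lemma L2_sum (I : Type) (s : seq I) (F : I -> 'rV[R]_d -> R) :
  (forall i, L2 D (F i)) -> L2 D (fun x => \sum_(i <- s) F i x).
Proof.
move=> LF; elim: s => [|i s IH].
  under eq_fun do rewrite big_nil.
  split; first exact: measurable_cst.
  by apply: (eq_integrable mD (cst 0%E)); [move=> x _; rewrite expr0n|exact: integrable0].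
by under eq_fun do rewrite big_cons; exact: L2D.
Qed.

Lemma L2vB g h : L2v D g -> L2v D h -> L2v D (fun x => g x - h x).
Proof.
move=> Lg Lh i; rewrite (_ : (fun _ => _) = (fun x => g x ord0 i - h x ord0 i)).
  exact: L2B.
by apply/funext => x; rewrite !mxE.
Qed.

Lemma integrable_dotv g h : L2v D g -> L2v D h ->
  mu.-integrable D (EFin \o (fun x => dotv (g x) (h x))).
Proof.
move=> Lg Lh.
apply: (eq_integrable mD (fun x => \sum_(i < d) (g x ord0 i * h x ord0 i)%:E)%E).
  by move=> x _; rewrite /= /dotv sumEFin.
by apply: integrable_sum => // i _; exact: L2_integrableM.
Qed.

Lemma dotvv_ge0 (x : 'rV[R]_d) : 0 <= dotv x x.
Proof. by apply: sumr_ge0 => i _; rewrite -expr2 sqr_ge0. Qed.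

Lemma L2normv_ge0 g : 0 <= L2normv D g. Proof. exact: sqrtr_ge0. Qed.

Lemma L2normv_sqr g : L2normv D g ^+ 2 = \int[mu]_(x in D) dotv (g x) (g x).
Proof. by rewrite sqr_sqrtr// Rintegral_ge0// => x _; exact: dotvv_ge0. Qed.

Lemma L2norm_coord_le g i : L2v D g -> L2norm D (fun x => g x ord0 i) <= L2normv D g.
Proof.
move=> Lg; rewrite -ler_sqr ?nnegrE ?sqrtr_ge0// L2normv_sqr L2norm_sqr.
apply: le_Rintegral => //; [by case: (Lg i)|exact: integrable_dotv|].
move=> x _; rewrite /dotv (bigD1 i)//= -expr2 lerDl.
by apply: sumr_ge0 => j _; rewrite -expr2 sqr_ge0.
Qed.

Lemma L2normv_le_sum g : L2v D g ->
  L2normv D g <= \sum_(i < d) L2norm D (fun x => g x ord0 i).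
Proof.
move=> Lg; rewrite -ler_sqr ?nnegrE ?sumr_ge0 ?sqrtr_ge0//; last first.
  by move=> i _; exact: sqrtr_ge0.
apply: le_trans (sum_sqr_le _ _); last by move=> i; exact: sqrtr_ge0.
rewrite L2normv_sqr /dotv Rintegral_sum//; last first.
  by move=> i; exact: (L2_integrableM mD (Lg i) (Lg i)).
by apply: ler_sum => i _; rewrite L2norm_sqr.
Qed.

Lemma H1norm_ge0 u g : 0 <= H1norm D u g. Proof. exact: sqrtr_ge0. Qed.

Lemma L2norm_le_H1norm u g : L2norm D u <= H1norm D u g.
Proof.
rewrite -ler_sqr ?nnegrE ?sqrtr_ge0// [leRHS]sqr_sqrtr ?addr_ge0 ?sqr_ge0//.
by rewrite lerDl sqr_ge0.
Qed.

Lemma L2normv_le_H1norm u g : L2normv D g <= H1norm D u g.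
Proof.
rewrite -ler_sqr ?nnegrE ?sqrtr_ge0// [leRHS]sqr_sqrtr ?addr_ge0 ?sqr_ge0//.
by rewrite lerDr sqr_ge0.
Qed.

Lemma H1norm_le_sum u g : L2v D g ->
  H1norm D u g <= L2norm D u + \sum_(i < d) L2norm D (fun x => g x ord0 i).
Proof.
move=> Lg; have s0 := L2normv_le_sum Lg.
have := L2normv_ge0 g; have := L2norm_ge0 (D := D) u.
move=> u0 g0; have S0 := le_trans g0 s0.
rewrite -ler_sqr ?nnegrE ?sqrtr_ge0 ?addr_ge0// [leLHS]sqr_sqrtr ?addr_ge0 ?sqr_ge0//.
by nra.
Qed.

Lemma H1normB_le u v g h : L2 D u -> L2 D v -> L2v D g -> L2v D h ->
  H1norm D (fun x => u x - v x) (fun x => g x - h x) <=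
  d.+1%:R * (H1norm D u g + H1norm D v h).
Proof.
move=> Lu Lv Lg Lh; apply: le_trans (H1norm_le_sum _ (L2vB Lg Lh)) _.
have tri w z : L2 D w -> L2 D z ->
    L2norm D (fun x => w x - z x) <= L2norm D w + L2norm D z.
  move=> Lw Lz; have := L2norm_triangle mD Lw (L2Z mD (-1) Lz).
  rewrite (L2normZ mD)// normrN1 mul1r.
  by under eq_fun do rewrite mulN1r.
rewrite -nat1r mulrDl mul1r; apply: lerD.
  by apply: le_trans (tri _ _ Lu Lv) _; rewrite lerD ?L2norm_le_H1norm.
rewrite -[X in X%:R * _]card_ord -sumr_const mulr_suml; apply: ler_sum => i _.
rewrite mul1r; under eq_fun do rewrite !mxE.
apply: le_trans (tri _ _ (Lg i) (Lh i)) _.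
by rewrite lerD// (le_trans (L2norm_coord_le _ _))// L2normv_le_H1norm.
Qed.

End vector_L2.

(** * Energy estimate in H^1_0 *)

Lemma squeeze_cvg0 (R : realType) (k : R) (a b z : nat -> R) :
  (forall n, 0 <= z n <= k * (a n + b n)) ->
  a @ \oo --> (0 : R) -> b @ \oo --> (0 : R) -> z @ \oo --> (0 : R).
Proof.
move=> zab a0 b0; apply: (@squeeze_cvgr _ _ _ _ (cst 0) (fun n => k * (a n + b n))).
- exact: nearW.
- exact: cvg_cst.
- have : k * (a n + b n) @[n --> \oo] --> k * (0 + 0) by exact: (cvgMr (cvgD a0 b0)).
  by rewrite addr0 mulr0.
Qed.

Section H10_theory.
Context {R : realType} {d : nat} {D : set 'rV[R]_d}.
Hypotheses (mD : measurable D) (Doo : (lebesgue_rV R d D < +oo)%E).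
Implicit Types (u v : 'rV[R]_d -> R) (g h : 'rV[R]_d -> 'rV[R]_d).

Lemma test_function_L2 O phi : test_function O phi -> L2 D phi.
Proof. by move=> [sphi cphi _]; exact: smooth_L2. Qed.

Lemma test_function_partial_L2 O i phi : test_function O phi -> L2 D (partial i phi).
Proof.
move=> [sphi cphi _]; apply: smooth_L2 => //; first exact: smooth_partial.
by apply: subclosed_compact (@support_partial _ _ i phi); first exact: closed_closure.
Qed.

Lemma test_function_grad_L2v O phi : test_function O phi -> L2v D (grad phi).
Proof.
move=> Ophi i; rewrite (_ : (fun _ => _) = partial i phi).
  exact: test_function_partial_L2 Ophi.
by apply/funext => x; rewrite mxE.
Qed.

Lemma weak_gradientB u v g h : H1 D u g -> H1 D v h ->
  weak_gradient D (fun x => u x - v x) (fun x => g x - h x).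
Proof.
move=> [Lu Lg wu] [Lv Lh wv] phi Dphi i.
have Lphi := test_function_L2 Dphi; have Lpphi := test_function_partial_L2 i Dphi.
under eq_Rintegral do rewrite mulrBl.
under [in RHS]eq_Rintegral do rewrite !mxE mulrBl.
rewrite !RintegralB//; try exact: L2_integrableM.
by rewrite wu// wv//; ring.
Qed.

Lemma H1B u v g h : H1 D u g -> H1 D v h ->
  H1 D (fun x => u x - v x) (fun x => g x - h x).
Proof.
move=> Hu Hv; have wuv := weak_gradientB Hu Hv.
by case: Hu Hv => Lu Lg _ [Lv Lh _]; split; [exact: L2B|exact: L2vB|].
Qed.

Lemma H10B u v g h : H10 D u g -> H10 D v h ->
  H10 D (fun x => u x - v x) (fun x => g x - h x).
Proof.
move=> [Hu [phi [Dphi phiu]]] [Hv [psi [Dpsi psiv]]]; split; first exact: H1B.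
exists (fun n x => phi n x - psi n x); split=> [n|]; first exact: test_functionB.
case: Hu Hv => Lu Lg _ [Lv Lh _].
apply: (squeeze_cvg0 (k := d.+1%:R)) phiu psiv => n; rewrite H1norm_ge0/=.
have [sphi _ _] := Dphi n; have [spsi _ _] := Dpsi n.
have Lp := test_function_L2 (Dphi n); have Lq := test_function_L2 (Dpsi n).
have Lgp := test_function_grad_L2v (Dphi n).
have Lgq := test_function_grad_L2v (Dpsi n).
have := H1normB_le mD (L2B mD Lp Lu) (L2B mD Lq Lv) (L2vB mD Lgp Lg) (L2vB mD Lgq Lh).
rewrite (gradB sphi spsi).
rewrite (_ : (fun x => _ - u x - _) = (fun x => phi n x - psi n x - (u x - v x))).
  rewrite (_ : (fun x => _ - g x - _) =
    (fun x => grad (phi n) x - grad (psi n) x - (g x - h x)))//.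
  by apply/funext => x; apply/rowP => i; rewrite !mxE; ring.
by apply/funext => x; ring.
Qed.

End H10_theory.

Lemma dotvBl (R : realType) d (x y z : 'rV[R]_d) : dotv (x - y) z = dotv x z - dotv y z.
Proof. by rewrite /dotv -sumrB; apply: eq_bigr => i _; rewrite !mxE mulrBl. Qed.

Lemma mxappB (R : realType) d (A : 'M[R]_d) (x y : 'rV[R]_d) :
  mxapp A (x - y) = mxapp A x - mxapp A y.
Proof. exact: mulmxBl. Qed.

Section energy.
Context {R : realType} {d : nat} {D : set 'rV[R]_d}.
Hypotheses (mD : measurable D) (Doo : (lebesgue_rV R d D < +oo)%E).
Variables (A0 : 'M[R]_d) (a0 cp c : R).
Hypotheses (a0_gt0 : 0 < a0) (cp_gt0 : 0 < cp) (c_ge0 : 0 <= c).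
Hypothesis ell : forall xi, a0 * dotv xi xi <= dotv (mxapp A0 xi) xi.
Hypothesis poincare : forall u g, H10 D u g ->
  L2norm D u ^+ 2 <= cp * L2normv D g ^+ 2.
Implicit Types (u v r s : 'rV[R]_d -> R) (g h : 'rV[R]_d -> 'rV[R]_d).

Lemma L2v_mxapp g : L2v D g -> L2v D (fun x => mxapp A0 (g x)).
Proof.
move=> Lg i.
rewrite (_ : (fun _ => _) = (fun x => \sum_(j < d) A0 i j * g x ord0 j)); last first.
  by apply/funext => x; rewrite mxE; apply: eq_bigr => j _; rewrite mxE mulrC.
by apply: L2_sum => // j; exact: L2Z.
Qed.

Lemma energy_estimate r s u v g h : L2 D r -> L2 D s ->
  macro_weak_solution A0 D c r u g -> macro_weak_solution A0 D c s v h ->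
  a0 * L2normv D (fun x => g x - h x) ^+ 2 + c * L2norm D (fun x => u x - v x) ^+ 2
    <= L2norm D (fun x => r x - s x) * L2norm D (fun x => u x - v x).
Proof.
move=> Lr Ls [Hu eu] [Hv ev].
have Hw := H10B mD Doo Hu Hv.
have [[Lu Lg _] _] := Hu; have [[Lv Lh _] _] := Hv; have [[Lw Le _] _] := Hw.
apply: le_trans (L2_cauchy_schwarz mD (L2B mD Lr Ls) Lw).
under eq_Rintegral do rewrite mulrBl.
rewrite RintegralB//; try exact: L2_integrableM.
rewrite -(eu _ _ Hw) -(ev _ _ Hw).
set I1 := Rintegral _ _ _; set I2 := Rintegral _ _ _.
set I3 := Rintegral _ _ _; set I4 := Rintegral _ _ _.
have -> : I1 + c * I2 - (I3 + c * I4) = (I1 - I3) + c * (I2 - I4) by ring.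
rewrite /I1 /I2 /I3 /I4 -!RintegralB//; try exact: L2_integrableM;
  try (apply: integrable_dotv => //; exact: L2v_mxapp).
apply: lerD.
  rewrite L2normv_sqr -RintegralZl//; last exact: integrable_dotv.
  under [leRHS]eq_Rintegral do rewrite -dotvBl -mxappB.
  apply: le_Rintegral => //.
  - apply: (eq_integrable mD (fun x => a0%:E * (dotv (g x - h x) (g x - h x))%:E)%E) => //.
    by apply: integrableZl => //; exact: integrable_dotv.
  - by apply: integrable_dotv => //; exact: L2v_mxapp.
rewrite L2norm_sqr ler_wpM2l//.
by under [leRHS]eq_Rintegral do rewrite -mulrBl -expr2.
Qed.

Lemma contraction_estimate r s u v g h : L2 D r -> L2 D s ->
  macro_weak_solution A0 D c r u g -> macro_weak_solution A0 D c s v h ->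
  L2norm D (fun x => u x - v x) <=
    (a0 / cp + c)^-1 * L2norm D (fun x => r x - s x).
Proof.
move=> Lr Ls su sv; have := energy_estimate Lr Ls su sv.
have [Hu _] := su; have [Hv _] := sv; have := poincare (H10B mD Doo Hu Hv).
have := L2norm_ge0 (D := D) (fun x => r x - s x).
have := L2norm_ge0 (D := D) (fun x => u x - v x).
have := L2normv_ge0 (D := D) (fun x => g x - h x).
set w := L2norm _ _; set z := L2norm _ _; set e := L2normv _ _ => e0 w0 z0 we en.
have k0 : 0 < a0 / cp + c by rewrite ltr_wpDr// divr_gt0.
rewrite ler_pdivlMl//.
move: w0; rewrite le_eqVlt => /predU1P[<-|w0]; first by rewrite mulr0.
rewrite -(ler_pM2r w0); apply: le_trans en.
rewrite mulrDl mulrDl -!mulrA -!expr2 lerD2r ler_pM2l//.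
by rewrite ler_pdivrMl.
Qed.

End energy.

(** * Geometric decay *)

Lemma geometric_decay (R : realFieldType) (q E w : R) (b : nat -> R) :
  0 <= q < 1 -> 0 < w < 1 -> 0 <= E ->
  (forall k, b k.+1 <= q * b k + E * w ^+ k) ->
  exists M rho, [/\ 0 <= M, w <= rho, 0 < rho < 1 & forall k, b k <= M * rho ^+ k].
Proof.
move=> /andP[q0 q1] /andP[w0 w1] E0 bq.
pose rho := (1 + Num.max q w) / 2.
have [qm wm] : q <= Num.max q w /\ w <= Num.max q w by rewrite !le_max !lexx orbT.
have m1 : Num.max q w < 1 by rewrite gt_max q1.
have qrho : q < rho by rewrite /rho; lra.
have wrho : w <= rho by rewrite /rho; lra.
have rho01 : 0 < rho < 1 by rewrite /rho; apply/andP; split; lra.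
have M0 : 0 <= E / (rho - q) by rewrite divr_ge0// subr_ge0 ltW.
exists (`|b 0%N| + E / (rho - q)), rho; split => //; first by rewrite addr_ge0.
have step : q * (`|b 0%N| + E / (rho - q)) + E <= (`|b 0%N| + E / (rho - q)) * rho.
  have eE : E / (rho - q) * (rho - q) = E by rewrite divfK// gt_eqF// subr_gt0.
  have := normr_ge0 (b 0%N); nra.
elim=> [|k IH].
  by rewrite expr0 mulr1; apply: le_trans (ler_norm _) _; rewrite lerDl.
apply: le_trans (bq k) _; rewrite exprS mulrA.
have rk0 : 0 <= rho ^+ k by rewrite exprn_ge0// ltW//; case/andP: rho01.
have wk : w ^+ k <= rho ^+ k by rewrite lerXn2r// nnegrE ltW//; case/andP: rho01.
apply: le_trans (ler_wpM2r rk0 step); rewrite mulrDl -mulrA.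
by apply: lerD; rewrite ler_wpM2l.
Qed.

Lemma geometric_small (R : realType) (K rho e : R) : 0 < rho < 1 -> 0 < e ->
  exists N : nat, K * rho ^+ N < e.
Proof.
move=> /andP[r0 r1] e0.
have /cvgrPdist_lt/(_ e e0)[N _ NK] : geometric K rho @ \oo --> (0 : R).
  by apply: cvg_geometric; rewrite gtr0_norm.
exists N; apply: le_lt_trans (NK N _) => /=; last exact: leqnn.
by rewrite sub0r normrN ler_norm.
Qed.

Section telescoping.
Context {R : realType} {d : nat} {D : set 'rV[R]_d} (mD : measurable D).
Variables (v : nat -> 'rV[R]_d -> R) (M rho : R).
Hypotheses (M0 : 0 <= M) (rho01 : 0 < rho < 1) (Lv : forall k, L2 D (v k)).
Hypothesis vM : forall k, L2norm D (fun x => v k.+1 x - v k x) <= M * rho ^+ k.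

Lemma L2norm_telescope n j :
  L2norm D (fun x => v (n + j)%N x - v n x) <= M * rho ^+ n / (1 - rho).
Proof.
have [r0 r1] := andP rho01.
suff : L2norm D (fun x => v (n + j)%N x - v n x)
    <= M * rho ^+ n / (1 - rho) * (1 - rho ^+ j).
  move=> /le_trans; apply; rewrite ler_piMr ?gerBl ?exprn_ge0 ?(ltW r0)//.
  by rewrite divr_ge0 ?mulr_ge0 ?exprn_ge0 ?subr_ge0 ?(ltW r0) ?(ltW r1).
elim: j => [|j IH].
  rewrite addn0 expr0 subrr mulr0; under eq_fun do rewrite subrr.
  by rewrite (L2norm_cst mD) normr0 mul0r.
rewrite addnS (_ : (fun x => _ - _) = (fun x => (v (n + j).+1 x - v (n + j)%N x) +
  (v (n + j)%N x - v n x))); last by apply/funext => x; ring.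
apply: le_trans (L2norm_triangle mD _ _) _; [exact: L2B..|].
apply: le_trans (lerD (vM _) IH) _.
rewrite le_eqVlt; apply/orP; left; apply/eqP; rewrite exprD exprS.
by field; rewrite subr_eq0 gt_eqF.
Qed.

Lemma L2norm_cauchy N m n : (N <= m)%N -> (N <= n)%N ->
  L2norm D (fun x => v m x - v n x) <= M * rho ^+ N / (1 - rho).
Proof.
have [r0 r1] := andP rho01.
wlog nm : m n / (n <= m)%N => [H|_ Nn].
  by case/orP: (leq_total n m) => nm *; [|rewrite L2normBC]; exact: H.
rewrite -(subnKC nm); apply: le_trans (L2norm_telescope _ _) _.
by rewrite ler_pM2r ?invr_gt0 ?subr_gt0// ler_wpM2l// ler_wiXn2l ?(ltW r0) ?(ltW r1).
Qed.

End telescoping.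

Section iteration.
Context {R : realType} {d : nat} {D : set 'rV[R]_d}.
Hypotheses (mD : measurable D) (Doo : (lebesgue_rV R d D < +oo)%E).
Variables (A0 : 'M[R]_d) (a0 cp c : R).
Hypotheses (a0_gt0 : 0 < a0) (cp_gt0 : 0 < cp) (c_ge0 : 0 <= c).
Hypothesis ell : forall xi, a0 * dotv xi xi <= dotv (mxapp A0 xi) xi.
Hypothesis poincare : forall u g, H10 D u g ->
  L2norm D u ^+ 2 <= cp * L2normv D g ^+ 2.

Lemma perturbed_iteration_cauchy (E w : R) (r u : nat -> 'rV[R]_d -> R)
    (g : nat -> 'rV[R]_d -> 'rV[R]_d) :
  0 <= E -> 0 < w < 1 -> L2 D (u 0%N) -> (forall k, L2 D (r k)) ->
  (forall k, macro_weak_solution A0 D c (r k) (u k.+1) (g k.+1)) ->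
  (forall k x, D x -> `|r k.+1 x - r k x| <= c * `|u k.+1 x - u k x| + E * w ^+ k) ->
  cauchy_H10 D (fun k => u k.+1) (fun k => g k.+1).
Proof.
move=> E0 w01 Lu0 Lr sol ru.
have [w0 w1] := andP w01.
have H10u k : H10 D (u k.+1) (g k.+1) by case: (sol k).
have Lu k : L2 D (u k) by case: k => // k; case: (H10u k) => -[].
have Lg k : L2v D (g k.+1) by case: (H10u k) => -[].
split => // e e0.
pose b k := L2norm D (fun x => u k.+1 x - u k x).
pose n1 := L2norm D (cst 1).
have rb k : L2norm D (fun x => r k.+1 x - r k x) <= c * b k + E * n1 * w ^+ k.
  have Lw : L2 D (fun x => `|u k.+1 x - u k x|).
    apply: L2_le (L2B mD (Lu k.+1) (Lu k)) _ => //; last by move=> x _; rewrite normr_id.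
    by apply: measurableT_comp => //; case: (L2B mD (Lu k.+1) (Lu k)).
  have Lc : L2 D (cst (E * w ^+ k)) by exact: L2_cst.
  have Ew0 : 0 <= E * w ^+ k by rewrite mulr_ge0// exprn_ge0// ltW.
  apply: (@le_trans _ _ (L2norm D (fun x => c * `|u k.+1 x - u k x| + E * w ^+ k))).
    apply: le_L2norm => //; first exact: L2B.
      by apply: L2D => //; exact: L2Z.
    by move=> x Dx; rewrite [leRHS]ger0_norm ?ru// addr_ge0// mulr_ge0.
  apply: le_trans (L2norm_triangle mD (L2Z mD c Lw) Lc) _.
  rewrite (L2normZ mD)// (ger0_norm c_ge0) (L2norm_cst mD (E * _)) (ger0_norm Ew0).
  rewrite -[E * n1 * _]mulrAC lerD2r ler_wpM2l//.
  by apply: le_L2norm => //; [exact: L2B|move=> x _; rewrite normr_id].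
pose kappa := a0 / cp + c.
have a0cp : 0 < a0 / cp by exact: divr_gt0.
have kappa0 : 0 < kappa by exact: ltr_wpDr.
have bb k : b k.+1 <= c / kappa * b k + E * n1 / kappa * w ^+ k.
  apply: le_trans (contraction_estimate mD Doo a0_gt0 cp_gt0 c_ge0 ell poincare
    (Lr k.+1) (Lr k) (sol k.+1) (sol k)) _.
  rewrite -/kappa ler_pdivrMl//; apply: le_trans (rb k) _.
  by rewrite le_eqVlt; apply/orP; left; apply/eqP; field; rewrite gt_eqF.
have n10 : 0 <= n1 by exact: L2norm_ge0.
have q01 : 0 <= c / kappa < 1.
  by rewrite divr_ge0 ?(ltW kappa0)//= ltr_pdivrMr// mul1r /kappa ltrDr.
have En : 0 <= E * n1 / kappa by rewrite divr_ge0 ?mulr_ge0 ?(ltW kappa0).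
have [M [rho [M0 wrho rho01 bM]]] := geometric_decay q01 w01 En bb.
have [r0 r1] := andP rho01.
pose P := (c * M + E * n1) * M / a0.
have P0 : 0 <= P by rewrite divr_ge0 ?mulr_ge0 ?addr_ge0 ?mulr_ge0 ?(ltW a0_gt0).
pose Q := M + Num.sqrt P.
have gM k : L2normv D (fun x => g k.+2 x - g k.+1 x) <= Num.sqrt P * rho ^+ k.
  have rk0 : 0 <= rho ^+ k by rewrite exprn_ge0// ltW.
  rewrite -ler_sqr ?nnegrE ?mulr_ge0 ?sqrtr_ge0// exprMn [Num.sqrt P ^+ 2]sqr_sqrtr//.
  have := energy_estimate mD Doo c_ge0 ell (Lr k.+1) (Lr k) (sol k.+1) (sol k).
  rewrite -/(b k.+1) => en.
  have bk0 : 0 <= b k.+1 by exact: L2norm_ge0.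
  have bk1 : b k.+1 <= M * rho ^+ k.
    by apply: le_trans (bM _) _; rewrite ler_wpM2l// exprS ler_piMl// (ltW r1).
  have rk : L2norm D (fun x => r k.+1 x - r k x) <= (c * M + E * n1) * rho ^+ k.
    have wk : w ^+ k <= rho ^+ k by rewrite lerXn2r// nnegrE ltW.
    apply: le_trans (rb k) _; rewrite mulrDl -[c * M * _]mulrA.
    by apply: lerD; apply: ler_wpM2l => //; exact: mulr_ge0.
  rewrite /P [leRHS]mulrAC ler_pdivlMr// mulrC.
  apply: (@le_trans _ _ (L2norm D (fun x => r k.+1 x - r k x) * b k.+1)).
    by apply: le_trans en; rewrite lerDl mulr_ge0// sqr_ge0.
  apply: le_trans (ler_pM (L2norm_ge0 _) bk0 rk bk1) _.
  by rewrite le_eqVlt; apply/orP; left; apply/eqP; ring.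
have [N NQ] := geometric_small (d.+1%:R * (Q / (1 - rho))) rho01 e0.
exists N => m n Nm Nn; apply: le_lt_trans NQ.
have Q0 : 0 <= Q by rewrite addr_ge0 ?sqrtr_ge0.
have MQ k : M * rho ^+ k <= Q * rho ^+ k.
  by rewrite ler_wpM2r ?lerDl ?sqrtr_ge0// exprn_ge0// ltW.
have SQ k : Num.sqrt P * rho ^+ k <= Q * rho ^+ k.
  by rewrite ler_wpM2r ?lerDr// exprn_ge0// ltW.
have uc : L2norm D (fun x => u m.+1 x - u n.+1 x) <= Q * rho ^+ N / (1 - rho).
  apply: (@L2norm_cauchy _ _ _ mD (fun k => u k.+1)) => // k.
  apply: le_trans (bM _) _; apply: le_trans (MQ _).
  by rewrite ler_wpM2l// exprS ler_piMl ?exprn_ge0 ?(ltW r0) ?(ltW r1).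
have gc i : L2norm D (fun x => (g m.+1 x - g n.+1 x) ord0 i) <= Q * rho ^+ N / (1 - rho).
  under eq_fun do rewrite !mxE.
  apply: (@L2norm_cauchy _ _ _ mD (fun k x => g k.+1 x ord0 i)) => // [k|k].
    exact: Lg.
  apply: le_trans (SQ k); apply: le_trans (gM k).
  rewrite (_ : (fun x => _ - _) = (fun x => (g k.+2 x - g k.+1 x) ord0 i)).
    by apply: (L2norm_coord_le mD (g := fun x => g k.+2 x - g k.+1 x)); exact: L2vB.
  by apply/funext => x; rewrite !mxE.
apply: le_trans (H1norm_le_sum mD _ (L2vB mD (Lg _) (Lg _))) _.
rewrite (_ : d.+1%:R * _ * _ = Q * rho ^+ N / (1 - rho) + \sum_(i < d) (Q * rho ^+ N / (1 - rho))).
  by apply: lerD => //; apply: ler_sum => i _; exact: gc.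
by rewrite sumr_const card_ord -[_ *+ d]mulr_natl -nat1r; ring.
Qed.

End iteration.

(** * Regularized nonlinearity *)

Section regularization_theory.
Context {R : realType} {F G : R -> R} {delta0 delta1 C sigma gamma : R}.
Hypothesis reg : regularization F delta0 delta1 C sigma gamma G.

Lemma regularization_continuous : continuous G.
Proof.
move=> x; apply: differentiable_continuous; apply/derivable1_diffP.
by case: (reg x).
Qed.

Lemma regularization_increment a b : a <= b -> 0 <= G b - G a <= delta1 * (b - a).
Proof.
move=> ab; have [x _||c _ ->] := @MVT_segment R G (derive1 G) a b ab.
- by rewrite derive1E; apply: derivableP; case: (reg x).
- exact/continuous_subspaceT/regularization_continuous.
have [_ g0 /andP[gc c1] _] := reg c.
by rewrite mulr_ge0 ?subr_ge0 ?(le_trans (ltW g0))//= ler_wpM2r// subr_ge0.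
Qed.

Lemma regularization_shift eta a b : 0 <= eta ->
  `|(eta + delta1) * (a - b) - (G a - G b)| <= (eta + delta1) * `|a - b|.
Proof.
move=> eta0; wlog ab : a b / b <= a => [H|].
  have [|/ltW] := leP b a; first exact: H.
  move=> /H; rewrite (_ : _ * (b - a) - _ = - ((eta + delta1) * (a - b) - (G a - G b))).
    by rewrite normrN [`|b - a|]distrC.
  by ring.
have /andP[g0 g1] := regularization_increment ab.
have ab0 : 0 <= a - b by rewrite subr_ge0.
by rewrite (ger0_norm ab0) ler_norml; apply/andP; split; nra.
Qed.

Lemma regularization_linear_growth a : 0 <= delta1 -> `|G a| <= `|G 0| + delta1 * `|a|.
Proof.
move=> d1; suff : `|G a - G 0| <= delta1 * `|a|.
  by move=> h; rewrite -[G a](subrK (G 0)) addrC (le_trans (ler_normD _ _))// lerD2l.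
have [a0|/ltW a0] := leP 0 a.
  have /andP[g0 g1] := regularization_increment a0.
  by rewrite !ger0_norm// -[a in leRHS]subr0.
have /andP[g0 g1] := regularization_increment a0.
by rewrite distrC !(ger0_norm g0) ler0_norm// -[- a]add0r.
Qed.

Lemma regularization_L2 d (D : set 'rV[R]_d) u : measurable D ->
  (lebesgue_rV R d D < +oo)%E -> 0 <= delta1 -> L2 D u -> L2 D (fun x => G (u x)).
Proof.
move=> mD Doo d1 Lu.
have Labs : L2 D (fun x => `|u x|).
  apply: (L2_le mD _ Lu) => //; last by move=> x _; rewrite normr_id.
  by apply: measurableT_comp => //; case: Lu.
apply: (L2_le mD _ (L2D mD (L2_cst mD `|G 0| Doo) (L2Z mD delta1 Labs))).
  apply: measurableT_comp; last by case: Lu.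
  by apply: continuous_measurable_fun; exact: regularization_continuous.
move=> x _ /=; rewrite [leRHS]ger0_norm ?addr_ge0 ?mulr_ge0//.
exact: regularization_linear_growth.
Qed.

End regularization_theory.

Lemma regularization_change (R : realType) (F G H : R -> R)
    (delta0 delta1 C sigma gamma gamma' x : R) :
  0 <= C -> 0 <= sigma -> 0 <= gamma' <= gamma ->
  regularization F delta0 delta1 C sigma gamma G ->
  regularization F delta0 delta1 C sigma gamma' H ->
  `|H x - G x| <= 2 * C * gamma `^ sigma.
Proof.
move=> C0 s0 /andP[g'0 gg] /(_ x)[_ _ _ FG] /(_ x)[_ _ _ FH].
have : gamma' `^ sigma <= gamma `^ sigma.
  by apply: ge0_ler_powR => //; rewrite nnegrE// (le_trans g'0).
move=> /(ler_wpM2l C0) Cg.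
rewrite (_ : H x - G x = (F x - G x) - (F x - H x)); last by ring.
apply: le_trans (ler_normB _ _) _; lra.
Qed.

Theorem theorem4 (R : realType) (d : nat) (hd : d = 2%N \/ d = 3%N)
  (* geometry *)
  (Omega B : set 'rV[R]_d)
  (hOmega : polyhedral_domain Omega)
  (hB : perforated_cell B)
  (hperf : forall e : R, 0 < e < 1 -> admissible_perforation Omega B e)
  (Cp : R) (hCp : 0 < Cp)
  (hpoincare_eps : forall e : R, 0 < e < 1 -> forall u g, V_eps Omega B e u g ->
     L2norm (perforated Omega B e) u ^+ 2
       <= Cp * L2normv (perforated Omega B e) g ^+ 2)
  (cp : R) (hcp : 0 < cp)
  (hpoincare : forall u g, H10 Omega u g ->
     L2norm Omega u ^+ 2 <= cp * L2normv Omega g ^+ 2)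
  (* (A1)-(A3) *)
  (A : 'rV[R]_d -> 'M[R]_d) (gamma_lo gamma_up : R) (hA1 : admissible_coefficient A gamma_lo gamma_up)
  (Rnl : R -> R) (x0 delta0 delta1 : R)
  (hA2 : degenerate_at Rnl x0 delta0 delta1)
  (f : 'rV[R]_d -> R) (hA3 : L2 Omega f)
  (* cell functions and homogenized coefficient *)
  (chi : 'I_d -> 'rV[R]_d -> R) (gchi : 'I_d -> 'rV[R]_d -> 'rV[R]_d)
  (hchi : forall i, cell_function A B i (chi i) (gchi i))
  (a0 : R) (ha0 : 0 < a0)
  (hell : forall xi, a0 * dotv xi xi
                     <= dotv (mxapp (homogenized A B gchi) xi) xi)
  (* scheme parameters *)
  (alpha eps eta : R)
  (halpha : 0 <= alpha) (heps : 0 < eps < 1) (heta : 0 < eta)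
  (gamma : nat -> R)
  (hgamma_pos : forall k, (1 <= k)%N -> 0 < gamma k)
  (hgamma_noninc : forall k, (1 <= k)%N -> gamma k.+1 <= gamma k)
  (Rg : R -> R -> R) (sigma Creg : R) (hsigma : 0 < sigma) (hCreg : 0 < Creg)
  (hreg : forall k, (1 <= k)%N ->
     regularization Rnl delta0 delta1 Creg sigma (gamma k) (Rg (gamma k)))
  (omega C : R) (homega : 0 < omega < 1) (hC : 0 < C)
  (hratio : forall k, (2 <= k)%N ->
     gamma k.-1 `^ sigma / gamma k <= C * omega ^+ k)
  (hcontr_eps : let M := eta + eps `^ alpha * delta1 in
     omega + Num.sqrt (M / (gamma_lo * Cp^-1 + M)) < 1)
  (hcontr : let m := (eta + delta1) * poreVol B in
     omega + Num.sqrt (m / (a0 * cp^-1 + m)) < 1)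
  (* macroscopic iteration *)
  (u : nat -> 'rV[R]_d -> R) (gradu : nat -> 'rV[R]_d -> 'rV[R]_d)
  (hu : macro_iteration (homogenized A B gchi) Omega (poreVol B) alpha eta
          delta1 f gamma Rg u gradu) :
  cauchy_H10 Omega (fun k => u k.+1) (fun k => gradu k.+1).
Proof.
have [[oD _ _] bD _] := hOmega.
have mD := open_measurable_rV oD.
have Doo := bounded_lebesgue_rV mD bD.
have d1 : 0 < delta1 by case: hA2.
have [w0 w1] := andP homega.
have Yl0 : 0 <= poreVol B by rewrite fine_ge0.
have [u0 sol] := hu.
have Lu0 : L2 Omega (u 0%N).
  by rewrite (_ : u 0%N = cst 0); [exact: L2_cst|apply/funext].
move: halpha; rewrite le_eqVlt => /predU1P[/esym alpha0|alpha_gt0].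
- pose r k x := poreVol B * f x + (eta + delta1) * poreVol B * u k x
    - poreVol B * Rg (gamma k.+1) (u k x).
  have solr k : macro_weak_solution (homogenized A B gchi) Omega
      ((eta + delta1) * poreVol B) (r k) (u k.+1) (gradu k.+1).
    by have [_] := sol k.+1 isT; exact.
  have Lu k : L2 Omega (u k) by case: k => // k; have [[[]]] := solr k.
  have Lr k : L2 Omega (r k).
    apply: L2B => //; first by apply: L2D => //; exact: L2Z.
    by apply: L2Z => //; apply: (regularization_L2 (hreg k.+1 isT)) => //; exact: ltW.
  have g1 k : gamma k.+1 <= gamma 1%N.
    by elim: k => // k; apply: le_trans; exact: hgamma_noninc.
  apply: (@perturbed_iteration_cauchy _ _ _ mD Doo (homogenized A B gchi) a0 cp
    ((eta + delta1) * poreVol B) _ _ _ _ _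
    (poreVol B * (2 * Creg * (C * gamma 1%N))) omega r) => //.
  + by rewrite mulr_ge0// addr_ge0// ltW.
  + by rewrite !mulr_ge0// ltW// hgamma_pos.
  move=> k x _.
  have regk := hreg k.+1 isT; have regk1 := hreg k.+2 isT.
  have gk : 0 <= gamma k.+2 <= gamma k.+1 by rewrite hgamma_noninc// ltW// hgamma_pos.
  have := regularization_change (u k.+1 x) (ltW hCreg) (ltW hsigma) gk regk regk1.
  have := regularization_shift regk (u k.+1 x) (u k x) (ltW heta).
  set I := (eta + delta1) * _ - _; set J := Rg _ _ - _ => hI hJ.
  rewrite (_ : r k.+1 x - r k x = poreVol B * (I - J)); last by rewrite /r /I /J; ring.
  have hg : gamma k.+1 `^ sigma <= C * gamma 1%N * omega ^+ k.
    have := hratio k.+2 isT; rewrite ler_pdivrMr ?hgamma_pos//= => /le_trans; apply.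
    rewrite -[leLHS]mulrA -[leRHS]mulrA ler_pM2l// [leRHS]mulrC.
    have := hgamma_pos k.+2 isT => /ltW gk0; have wk := exprn_ge0 k.+2 (ltW w0).
    have wk2 : omega ^+ k.+2 <= omega ^+ k.
      by rewrite ler_wiXn2l ?(ltW w0) ?(ltW w1)// ltnW.
    by apply: ler_pM => //; exact: g1.
  rewrite (mulrC (eta + delta1)) -!mulrA -mulrDr normrM (ger0_norm Yl0) ler_wpM2l//.
  apply: le_trans (ler_normB _ _) _; apply: lerD => //; apply: le_trans hJ _.
  by rewrite -mulrA ler_pM2l// ler_pM2l// mulrA.
- pose r k x := poreVol B * f x + eta * poreVol B * u k x.
  have solr k : macro_weak_solution (homogenized A B gchi) Omega
      (eta * poreVol B) (r k) (u k.+1) (gradu k.+1).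
    by have [+ _] := sol k.+1 isT; exact.
  have Lu k : L2 Omega (u k) by case: k => // k; have [[[]]] := solr k.
  have c0 : 0 <= eta * poreVol B by rewrite mulr_ge0// ltW.
  apply: (@perturbed_iteration_cauchy _ _ _ mD Doo (homogenized A B gchi) a0 cp
    (eta * poreVol B) _ _ _ _ _ 0 omega r) => //.
  + by move=> k; apply: L2D => //; exact: L2Z.
  move=> k x _; rewrite mul0r addr0 (_ : r k.+1 x - r k x =
    eta * poreVol B * (u k.+1 x - u k x)); last by rewrite /r; ring.
  by rewrite normrM ger0_norm.
Qed.
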